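(* For every multi-index $\mathbf{k}$ with $\operatorname{wt}(\mathbf{k})=-1$, the coproduct $\Delta_{\mathrm{LOT}}$ satisfies $$\Delta_{\mathrm{LOT}}(\mathbf{x}^{\mathbf{k}})=\sum_{r\ge 0}\ \sum_{\substack{\mathbf{k}=\mathbf{k}^{1}+\cdots+\mathbf{k}^{r}+\mathbf{b}\\ \operatorname{wt}(\mathbf{k}^{i})=-1,\ 1\le i\le r}}\frac{\mathbf{k}!}{\sigma(\mathbf{x}^{\mathbf{k}^{1}}\odot\cdots\odot\mathbf{x}^{\mathbf{k}^{r}})\,\mathbf{b}!}\sum_{|\boldsymbol\ell|=r}C_{\mathbf{b},\boldsymbol\ell}\ \mathbf{x}^{\mathbf{k}^{1}}\odot\cdots\odot\mathbf{x}^{\mathbf{k}^{r}}\otimes\mathbf{x}^{\mathbf{b}-\boldsymbol\ell+\overleftarrow{\boldsymbol\ell}}$$ and $$\Delta_{\mathrm{LOT}}(\mathbf{x}^{\mathbf{k}})=\sum_{r\ge 0}\ \sum_{\substack{\mathbf{k}=\mathbf{k}^{1}+\cdots+\mathbf{k}^{r}+\mathbf{b}\\ \operatorname{wt}(\mathbf{k}^{i})=-1,\ 1\le i\le r}}\frac{\mathbf{k}!}{\sigma(\mathbf{x}^{\mathbf{k}^{1}}\odot\cdots\odot\mathbf{x}^{\mathbf{k}^{r}})\,\mathbf{b}!}\sum_{\substack{|\boldsymbol\ell|=r\\ \mathbf{b}-\boldsymbol\ell+\overleftarrow{\boldsymbol\ell}\ge\mathbf{0}}}\frac{D_{\mathbf{b},\boldsymbol\ell}}{(\mathbf{b}-\boldsymbol\ell+\overleftarrow{\boldsymbol\ell})!}\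 \mathbf{x}^{\mathbf{k}^{1}}\odot\cdots\odot\mathbf{x}^{\mathbf{k}^{r}}\otimes\mathbf{x}^{\mathbf{b}-\boldsymbol\ell+\overleftarrow{\boldsymbol\ell}},$$ where $\boldsymbol\ell$ ranges over lowering multi-indices.
   Context: $A$ is a finite set, $\mathbb{K}$ is a field of characteristic zero, and $I_A:=A\times\mathbb{Z}_{\ge -1}$. A multi-index is a finitely supported map $\mathbf{k}:I_A\to\mathbb{Z}_{\ge 0}$, written $k_j^a:=\mathbf{k}(a,j)$; $|\mathbf{k}|=\sum_{a,j}k_j^a$, $\operatorname{wt}(\mathbf{k})=\sum_{a,j}j\,k_j^a$, $\mathbf{k}!:=\prod_{a,j}k_j^a!$ (over $a\in A$, $j\ge -1$). Sums, differences and inequalities of multi-indices are componentwise. $N(A)$ is the polynomial algebra over $\mathbb{K}$ in the variables $x_j^a$ ($a\in A$, $j\ge -1$), and $\mathbf{x}^{\mathbf{k}}:=\prod_{a,j}(x_j^a)^{k_j^a}$, with $\sigma(\mathbf{x}^{\mathbf{k}}):=\mathbf{k}!$. $\bar\partial:N(A)\to N(A)$ is the derivation with $\bar\partial(x_j^a)=x_{j-1}^a$ for $j\ge 0$ and $\bar\partial(x_{-1}^a)=0$. Let $\mathcal{V}$ be the span of the monomials $\mathbf{x}^{\mathbf{k}}$ with $\operatorname{wt}(\mathbf{k})=-1$; $\odot$ denotes the (commutative) product of the symmetric algebra $S(\mathcal{V})$, distinct from the product of $N(A)$. The symmetry factor $\sigma(\mathbf{x}^{\mathbf{k}^1}\odot\cdots\odot\mathbf{x}^{\mathbf{k}^r})$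 is $\prod_{i=1}^r\sigma(\mathbf{x}^{\mathbf{k}^i})$ times the product of the factorials of the multiplicities of the distinct multi-indices occurring among $\mathbf{k}^1,\dots,\mathbf{k}^r$. The coproduct is the linear map $\Delta_{\mathrm{LOT}}$ given for $\operatorname{wt}(\mathbf{k})=-1$ by $$\Delta_{\mathrm{LOT}}(\mathbf{x}^{\mathbf{k}})=\sum_{r\ge 0}\ \sum_{\substack{\mathbf{k}=\mathbf{k}^{1}+\cdots+\mathbf{k}^{r}+\mathbf{b}\\ \operatorname{wt}(\mathbf{k}^{i})=-1,\ 1\le i\le r}}\frac{\mathbf{k}!}{\sigma(\mathbf{x}^{\mathbf{k}^{1}}\odot\cdots\odot\mathbf{x}^{\mathbf{k}^{r}})\,\mathbf{b}!}\ \mathbf{x}^{\mathbf{k}^{1}}\odot\cdots\odot\mathbf{x}^{\mathbf{k}^{r}}\otimes\bar\partial^{\,r}\mathbf{x}^{\mathbf{b}},$$ where (here and in the claim) the inner sum is over pairs consisting of an unordered collection (multiset) $\{\mathbf{k}^1,\dots,\mathbf{k}^r\}$ of multi-indices of weight $-1$ and a multi-index $\mathbf{b}$, with total sum $\mathbf{k}$; for $r=0$ the empty $\odot$-product is the unit $1$ with symmetry factor $1$. A lowering multi-index is a multi-index $\boldsymbol\ell$ on $I_A$ with $\ell_{-1}^a=0$ for all $a\in A$; its left shift $\overleftarrow{\boldsymbol\ell}$ is the multi-index with $(\overleftarrow{\boldsymbol\ell})_j^a:=\ell_{j+1}^a$ for $a\in A$, $j\ge -1$. For a multi-index $\mathbf{b}$,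 the integers $C_{\mathbf{b},\boldsymbol\ell}$ ($\boldsymbol\ell$ lowering) are the unique integers with $$\bar\partial^{\,r}\mathbf{x}^{\mathbf{b}}=\sum_{|\boldsymbol\ell|=r}C_{\mathbf{b},\boldsymbol\ell}\,\mathbf{x}^{\mathbf{b}-\boldsymbol\ell+\overleftarrow{\boldsymbol\ell}}\qquad(r\ge 0)$$ and $C_{\mathbf{b},\boldsymbol\ell}=0$ whenever $\mathbf{b}-\boldsymbol\ell+\overleftarrow{\boldsymbol\ell}$ has a negative component (monomials with a negative exponent are understood to be zero). Define $D_{\mathbf{b},\boldsymbol\ell}:=C_{\mathbf{b},\boldsymbol\ell}\,(\mathbf{b}-\boldsymbol\ell+\overleftarrow{\boldsymbol\ell})!$ if $\mathbf{b}-\boldsymbol\ell+\overleftarrow{\boldsymbol\ell}\ge\mathbf{0}$, and $D_{\mathbf{b},\boldsymbol\ell}:=0$ otherwise. *)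

(* Defs.v *)
(* MathComp, with the free modules and monoid algebras of multinomials/monalg
   and the finitely supported sums of mathcomp-classical. *)
From HB Require Import structures.
From mathcomp Require Import all_boot all_order all_algebra finmap.
From mathcomp Require Import monalg.
From mathcomp Require Import boolp classical_sets functions cardinality fsbigop.
From mathcomp Require Import zify ring.

Set Implicit Arguments.
Unset Strict Implicit.
Unset Printing Implicit Defensive.

Import Order.TTheory GRing.Theory Num.Theory.

Local Open Scope fset_scope.
Local Open Scope classical_set_scope.
Local Open Scope ring_scope.

Section LinearExtension.
Context {M : choiceType} {K : fieldType} {U : lmodType K}.
Implicit Types (h : M -> U) (p q : {malg K[M]}).

Definition lext h p : U := \sum_(m <- msupp p) p@_m *: h m.

Lemma lextEw h p (D : {fset M}) : (msupp p `<=` D)%fset ->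
  lext h p = \sum_(m <- D) p@_m *: h m.
Proof.
move=> sD; rewrite /lext (big_fset_incl _ sD) // => m _ /mcoeff_outdom ->.
by rewrite scale0r.
Qed.

Lemma lext_linear h : linear (lext h).
Proof.
move=> c p q; pose D := (msupp p `|` msupp q)%fset.
have sp : (msupp p `<=` D)%fset by exact: fsubsetUl.
have sq : (msupp q `<=` D)%fset by exact: fsubsetUr.
have spq : (msupp (c *: p + q) `<=` D)%fset.
  apply: (fsubset_trans (msuppD_le _ _)); apply: fsetUSS => //.
  exact: msuppZ_le.
rewrite (lextEw _ sp) (lextEw _ sq) (lextEw _ spq) scaler_sumr -big_split /=.
by apply: eq_bigr => m _; rewrite mcoeffD mcoeffZ scalerDl scalerA.
Qed.

HB.instance Definition _ h :=
  GRing.isLinear.Build K {malg K[M]} U *:%R (lext h) (lext_linear h).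

Lemma lextU h c m : lext h << c *g m >> = c *: h m.
Proof. by rewrite (lextEw _ msuppU_le) big_seq_fset1 mcoeffUU. Qed.

Lemma malgUZ c m : << c *g m >> = c *: << m >> :> {malg K[M]}.
Proof. by apply/malgP => j; rewrite [RHS]mcoeffZ !mcoeffU mulrnAr mulr1. Qed.

Lemma malgE p : p = \sum_(m <- msupp p) p@_m *: << m >>.
Proof.
rewrite {1}[p]monalgE; apply: eq_bigr => m _; exact: malgUZ.
Qed.

End LinearExtension.

(* The tensor product of the free modules on M and M' is realised as the free
   module on M * M'. *)
Section Tensor.
Context {M M' : choiceType} {K : fieldType}.

Definition tens (p : {malg K[M]}) (q : {malg K[M']}) : {malg K[(M * M')%type]} :=
  lext (fun m => lext (fun m' => << (m, m') >>) q) p.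

Lemma tensU m m' : tens << m >> << m' >> = << (m, m') >>.
Proof. by rewrite /tens !lextU !scale1r. Qed.

Lemma tens_linearl q : linear (tens^~ q).
Proof. by move=> c p p'; rewrite /tens linearP. Qed.

Lemma tens_linearr p : linear (tens p).
Proof.
move=> c q q'; rewrite /tens /lext scaler_sumr -big_split /=.
apply: eq_bigr => m _; rewrite -/(lext _ _) linearP scalerDr !scalerA.
by rewrite mulrC.
Qed.

End Tensor.

(* The pair (a, n) encodes the index (a, j) with j = n - 1, so that n : nat
   ranges over j >= -1.  The monomial structure of {cmonom _} is written
   multiplicatively: mmul k b is the componentwise sum of k and b. *)
Notation index A := (Finite.sort A * nat)%type.
Notation multiindex A := {cmonom (index A)}.

Section Monomials.
Context {J : choiceType}.
Implicit Types (m : {cmonom J}) (j : J).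

Lemma expcmnE m n j : expcmn m n j = (n * m j)%N.
Proof.
rewrite /expcmn; elim: n => [|[|n] IHn]; first by rewrite onecmE.
  by rewrite mul1n.
by rewrite iteropS mulcmE; move: IHn; rewrite iteropS => ->; rewrite mulSn.
Qed.

Lemma cm_big (S : Type) (s : seq S) (f : S -> {cmonom J}) j :
  (\big[mmul/mone]_(i <- s) f i) j = (\sum_(i <- s) f i j)%N.
Proof.
by elim/big_rec2: _ => [|i n m _ <-]; [exact: cm1|exact: cmM].
Qed.

Lemma cm_expand m :
  \big[mmul/mone]_(j <- finsupp m) expcmn (ucm j) (m j) = m.
Proof.
apply/eqP/cmP => j; rewrite cm_big.
have [jm|jm] := mdomP m j.
  rewrite (big_fsetD1 j) //= expcmnE cmUU muln1 big_seq big1 ?addn0 // => i.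
  by rewrite in_fsetD1 expcmnE cmU => /andP[/negPf-> _]; rewrite muln0.
rewrite big_seq big1 // => i im; rewrite expcmnE cmU.
by case: eqP im jm => [-> ->|_]; rewrite ?muln0.
Qed.

Lemma finite_box (X : {fset J}) (n : nat) :
  finite_set [set m : {cmonom J} | (finsupp m `<=` X)%fset /\
                                   forall j, (m j <= n)%N].
Proof.
pose g (f : {ffun X -> 'I_n.+1}) : {cmonom J} :=
  [cmonom if insub j is Some x then nat_of_ord (f x) else 0%N | j in X]%M.
apply: (@sub_finite_set _ _ (g @` setT)); last first.
  exact/finite_image/finite_finset.
move=> m [sX le_n]; exists [ffun x => inord (m (val x))] => //.
apply/eqP/cmP => j; rewrite /g cmE fsfun_fun; case: ifPn => jX.
  by rewrite insubT ffunE inordK // ltnS.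
by case: mdomP => // /(fsubsetP sX); rewrite (negPf jX).
Qed.

End Monomials.

Lemma malgUM (M : conomType) (K : fieldType) (m m' : M) :
  << m >> * << m' >> = << mmul m m' >> :> {malg K[M]}.
Proof. by rewrite malgM_def fgmulUU mulr1. Qed.

(* The basis << m >> is abstracted as e, as comparing two distinct basis
   elements up to conversion does not terminate in practice. *)
Section Basis.
Context {M : conomType} {K : fieldType} {e : M -> {malg K[M]}}.
Hypothesis eE : forall m, e m = << m >>.
Notation N := {malg K[M]}.

Lemma basisM m m' : e m * e m' = e (mmul m m').
Proof. by rewrite !eE malgUM. Qed.

Lemma basis_coef m m' : (e m)@_m' = (m == m')%:R.
Proof. by rewrite eE mcoeffU. Qed.

Lemma basis_expand (p : N) : p = \sum_(m <- msupp p) p@_m *: e m.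
Proof. by rewrite {1}[p]malgE; apply: eq_bigr => m _; rewrite eE. Qed.

Lemma malgAr (c : K) (p q : N) : p * (c *: q) = c *: (p * q).
Proof. by rewrite mulrC -scalerAl mulrC. Qed.

Lemma leibniz_mon (c c' : nat) (x y z k b : M) :
  (c != 0%N -> x = mmul y b) -> (c' != 0%N -> x = mmul k z) ->
  (c + c')%:R *: e x = (c%:R *: e y) * e b + e k * (c'%:R *: e z).
Proof.
move=> xy xz; rewrite natrD scalerDl; congr (_ + _).
  case: c xy => [|c] xy; first by rewrite !scale0r mul0r.
  by rewrite xy // -basisM -scalerAl.
case: c' xz => [|c'] xz; first by rewrite !scale0r mulr0.
by rewrite xz // -basisM malgAr.
Qed.

Lemma leibniz_ext (d : {linear N -> N}) :
  (forall m m', d (e m * e m') = d (e m) * e m' + e m * d (e m')) ->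
  forall p q, d (p * q) = d p * q + p * d q.
Proof.
move=> dU p q; have dUq m : d (e m * q) = d (e m) * q + e m * d q.
  rewrite [q]basis_expand mulr_sumr !linear_sum /= !mulr_sumr -big_split /=.
  by apply: eq_bigr => m' _; rewrite malgAr !linearZ /= !malgAr dU scalerDr.
rewrite [p]basis_expand mulr_suml !linear_sum /= !mulr_suml -big_split /=.
by apply: eq_bigr => m _; rewrite -scalerAl !linearZ /= dUq scalerDr !scalerAl.
Qed.

End Basis.

Section MonomialAlgebra.
Context {J : choiceType} {K : fieldType}.
Implicit Types (m : {cmonom J}).

Lemma malgUX m n : << m >> ^+ n = << expcmn m n >> :> {malg K[{cmonom J}]}.
Proof.
elim: n => [|n IHn]; first by [].
rewrite exprS IHn malgUM; congr << _ >>; apply/eqP/cmP => j.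
by rewrite cmM !expcmnE mulSn.
Qed.

Lemma malgU_expand m :
  \prod_(j <- finsupp m) << ucm j >> ^+ m j = << m >> :> {malg K[{cmonom J}]}.
Proof.
rewrite -[in RHS](cm_expand m).
elim/big_rec2: _ => [|j p q _ ->] //; by rewrite malgUX malgUM.
Qed.

End MonomialAlgebra.

Section MultiIndices.
Variable A : finType.
Implicit Types (i : index A) (k b l : multiindex A).

Definition jval i : int := i.2%:Z - 1.

Definition wt k : int := \sum_(i <- finsupp k) jval i * (k i)%:Z.

Definition mfact k : nat := (\prod_(i <- finsupp k) (k i)`!)%N.

Definition is_lowering l : bool := [forall a : A, l (a, 0%N) == 0%N].

Definition lshift l : multiindex A :=
  [cmonom l (i.1, i.2.+1) | i in [fset (i.1, i.2.-1) | i in finsupp l]%fset]%M.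

Lemma lshiftE l i : lshift l i = l (i.1, i.2.+1).
Proof.
rewrite cmE fsfun_fun; case: ifPn => // iNl; apply/esym/eqP; rewrite cmE_eq0.
by apply: contra iNl => il; apply/imfsetP; exists (i.1, i.2.+1); case: i il.
Qed.

(* b - l + lshift l as an integer-valued map *)
Definition lowerz b l i : int := (b i)%:Z - (l i)%:Z + (lshift l i)%:Z.

Definition lower_ge0 b l : Prop := forall i, 0 <= lowerz b l i.

(* b - l + lshift l as a multi-index; meaningful only under lower_ge0 b l *)
Definition lower b l : multiindex A := divcm (mmul b (lshift l)) l.

Lemma lowerE b l i : lower_ge0 b l -> (lower b l i)%:Z = lowerz b l i.
Proof.
by move=> /(_ i); rewrite /lower divcmE cmM /lowerz; lia.
Qed.

End MultiIndices.

(* the multi-indices of weight -1, which index a basis of V *)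
Notation wtm1 A := {k : multiindex A | wt k == -1}.
(* multisets of such multi-indices, given by their multiplicities *)
Notation multiset A := {cmonom (wtm1 A)}.
Notation lowering A := {l : multiindex A | is_lowering l}.

Lemma leq_mdeg (J : choiceType) (m : {cmonom J}) j : (m j <= mdeg m)%N.
Proof. by case: mdomP => // jm; rewrite mdegE (big_fsetD1 j) //= leq_addr. Qed.

Lemma mdeg_expcmn (J : choiceType) (m : {cmonom J}) n :
  mdeg (expcmn m n) = (n * mdeg m)%N.
Proof.
elim: n => [|n IHn]; first exact: mdeg1.
suff -> : expcmn m n.+1 = mmul m (expcmn m n) by rewrite mdegM IHn mulSn.
by apply/eqP/cmP => j; rewrite cmM !expcmnE mulSn.
Qed.

Section Lowering.
Variable A : finType.
Implicit Types (b : multiindex A) (l : lowering A).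

Lemma lowering0 l (a : A) : val l (a, 0%N) = 0%N.
Proof. by case: l => l /= /forallP/(_ a)/eqP. Qed.

Lemma lower_inj b l l' : lower_ge0 b (val l) -> lower_ge0 b (val l') ->
  lower b (val l) = lower b (val l') -> l = l'.
Proof.
move=> l_ge0 l'_ge0 e; apply/val_inj/eqP/cmP => -[a n].
elim: n => [|n IHn]; first by rewrite !lowering0.
have := lowerE (a, n) l_ge0; rewrite e (lowerE (a, n) l'_ge0).
by rewrite /lowerz !lshiftE IHn /=; lia.
Qed.

(* for fixed b and r, the sum over |l| = r has finitely many nonzero terms *)
Lemma finite_lower b (r : nat) :
  finite_set [set l : lowering A | mdeg (val l) = r /\ lower_ge0 b (val l)].
Proof.
pose n0 := (\max_(i <- finsupp b) i.2.+1)%N.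
pose X := [fset x in [seq (a, n) | a <- enum A, n <- iota 0 n0]]%fset.
have b0 a n : (n0 <= n)%N -> b (a, n) = 0%N.
  move=> le_n; case: mdomP => // ib; suff: (n < n0)%N by rewrite ltnNge le_n.
  by rewrite /n0 (big_fsetD1 (a, n)) //= leq_max leqnn.
have fX := finite_box X r.
apply: (sub_finite_set _ (finite_preimage (f := val) _ fX)); last first.
  by move=> ? ? _ _; exact: val_inj.
move=> l [lr l_ge0]; split=> [|j]; last by rewrite -lr; exact: leq_mdeg.
pose n1 := (\max_(i <- finsupp (val l)) i.2.+1)%N.
have l0 a n : (n1 <= n)%N -> val l (a, n) = 0%N.
  move=> le_n; case: mdomP => // il; suff: (n < n1)%N by rewrite ltnNge le_n.
  by rewrite /n1 (big_fsetD1 (a, n)) //= leq_max leqnn.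
have lS a n : (n0 <= n)%N -> (val l (a, n) <= val l (a, n.+1))%N.
  move=> le_n; have := l_ge0 (a, n); rewrite /lowerz b0 // lshiftE /=.
  by move: (sval l _) (sval l _) => u v; lia.
have lD a n d : (n0 <= n)%N -> (val l (a, n) <= val l (a, n + d)%N)%N.
  move=> le_n; elim: d => [|d IHd]; first by rewrite addn0.
  by rewrite addnS (leq_trans IHd) // lS // (leq_trans le_n) // leq_addr.
apply/fsubsetP => -[a n] il; rewrite in_fset; apply/allpairsP; exists (a, n).
rewrite /= mem_enum mem_iota add0n; split=> //.
rewrite ltnNge; apply: contraL il => le_n; rewrite -cmE_eq0 -leqn0.
by rewrite (leq_trans (lD a n n1 le_n)) // l0 ?leq_addl.
Qed.

End Lowering.

Section Multisets.
Variable A : finType.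
Implicit Types (i : index A) (k b : multiindex A) (F : multiset A).

Definition msum F : multiindex A :=
  \big[mmul/mone]_(w <- finsupp F) expcmn (val w) (F w).

Lemma msumE F i : msum F i = (\sum_(w <- finsupp F) F w * val w i)%N.
Proof. by rewrite /msum cm_big; apply: eq_bigr => w _; rewrite expcmnE. Qed.

Definition symfactor F : nat :=
  ((\prod_(w <- finsupp F) mfact (val w) ^ F w)
   * \prod_(w <- finsupp F) (F w)`!)%N.

(* the pairs ({k^1, ..., k^r}, b) with k = k^1 + ... + k^r + b *)
Definition decomp k (r : nat) : set (multiset A * multiindex A) :=
  [set p | mdeg p.1 = r /\ k = mmul (msum p.1) p.2].

(* decomp_le and finite_decomp: the finitely supported sums over r and over
   decomp k r used below are genuine finite sums. *)
Lemma decomp_le k r p : decomp k r p -> (r <= mdeg k)%N.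
Proof.
move=> [<- ->]; rewrite mdegM /msum mdeg_prod.
apply: leq_trans (leq_addr _ _); apply: leq_sum => w _.
rewrite mdeg_expcmn leq_pmulr // lt0n mdeg_eq0.
apply: contraTneq (valP w) => ->; by rewrite /wt mdom1 big_seq_fset0.
Qed.

Lemma finite_decomp k r : finite_set (decomp k r).
Proof.
pose B := [set b : multiindex A | (finsupp b `<=` finsupp k)%fset /\
                                  forall i, (b i <= mdeg k)%N].
have fB : finite_set B := finite_box (finsupp k) (mdeg k).
have leB b : (forall i, b i <= k i)%N -> B b.
  move=> le_bk; split=> [|i]; last exact: leq_trans (le_bk i) (leq_mdeg k i).
  apply/fsubsetP => i; rewrite -!cmE_neq0 -!lt0n => bi.
  exact: leq_trans (le_bk i).
have fW : finite_set [set w : wtm1 A | B (val w)].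
  by apply: finite_preimage fB => ? ? _ _; exact: val_inj.
have fF := finite_box (fset_set [set w : wtm1 A | B (val w)]) r.
apply: sub_finite_set (finite_setX fF fB) => -[F b] [/= Fr kE]; split=> /=.
  split=> [|w]; last by rewrite -Fr leq_mdeg.
  apply/fsubsetP => w wF; rewrite in_fset_set // inE /=; apply: leB => i.
  rewrite kE cmM msumE (big_fsetD1 w) //= -addnA.
  by apply: leq_trans (leq_addr _ _); rewrite leq_pmull // lt0n cmE_neq0.
by apply: leB => i; rewrite kE cmM leq_addl.
Qed.

End Multisets.

Section Algebra.
Variables (A : finType) (K : fieldType).
Implicit Types (i : index A) (k b : multiindex A) (l : lowering A).

Notation N := {malg K[multiindex A]}.
(* the symmetric algebra of V, as the polynomial algebra on a basis of V *)
Notation SV := {malg K[multiset A]}.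

Definition xvar i : N := << ucm i >>.

Definition xmon k : N := \prod_(i <- finsupp k) xvar i ^+ k i.

Definition odot (F : multiset A) : SV := \prod_(w <- finsupp F) << ucm w >> ^+ F w.

Lemma xmonE k : xmon k = << k >>.
Proof. exact: malgU_expand. Qed.

Lemma odotE (F : multiset A) : odot F = << F >>.
Proof. exact: malgU_expand. Qed.

Lemma xmonM k b : xmon k * xmon b = xmon (mmul k b).
Proof. exact: (basisM xmonE). Qed.

Lemma xmon_coef k b : (xmon k)@_b = (k == b)%:R.
Proof. exact: (basis_coef xmonE). Qed.

(* the value on x^k of the derivation dbar = sum_{a, j >= 0} x_{j-1}^a d/dx_j^a *)
Definition dbar_mon k : N :=
  \sum_(i <- finsupp k | (0 < i.2)%N)
    (k i)%:R *: xmon (mmul (ucm (i.1, i.2.-1)) (divcm k (ucm i))).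

Definition dbar : N -> N := lext dbar_mon.

Lemma dbar_linear : linear dbar.
Proof. exact: lext_linear. Qed.

HB.instance Definition _ := GRing.isLinear.Build K N N *:%R dbar dbar_linear.

Lemma dbar_xmon k : dbar (xmon k) = dbar_mon k.
Proof. by rewrite xmonE /dbar lextU scale1r. Qed.

Lemma dbar_monEw (D : {fset (index A)}) k : (finsupp k `<=` D)%fset ->
  dbar_mon k = \sum_(i <- D | (0 < i.2)%N)
    (k i)%:R *: xmon (mmul (ucm (i.1, i.2.-1)) (divcm k (ucm i))).
Proof.
move=> sD; rewrite /dbar_mon !(big_mkcond (fun i => (0 < i.2)%N)).
rewrite (big_fset_incl _ sD) // => i _ /=; rewrite -cmE_eq0 => /eqP->.
by rewrite scale0r if_same.
Qed.

Lemma dbar_xvar i : dbar (xvar i) = if i.2 is n.+1 then xvar (i.1, n) else 0.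
Proof.
rewrite /xvar -xmonE dbar_xmon /dbar_mon mdomU big_mkcond big_seq_fset1 cmUU.
case: i => a [|n]; first by [].
rewrite /= scale1r -xmonE; congr xmon; apply/eqP/cmP => j.
by rewrite cmM divcmE subnn addn0.
Qed.

Lemma dbar_monM k b :
  dbar_mon (mmul k b) = dbar_mon k * xmon b + xmon k * dbar_mon b.
Proof.
pose D := (finsupp k `|` finsupp b)%fset.
have sk : (finsupp k `<=` D)%fset by exact: fsubsetUl.
have sb : (finsupp b `<=` D)%fset by exact: fsubsetUr.
have skb : (finsupp (mmul k b) `<=` D)%fset by rewrite mdomD.
rewrite (dbar_monEw sk) (dbar_monEw sb) (dbar_monEw skb).
rewrite mulr_suml mulr_sumr -big_split /=; apply: eq_bigr => i _.
rewrite cmM; apply: (leibniz_mon xmonE) => ki; apply/eqP/cmP => j;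
  by rewrite !(cmM, divcmE, cmU); case: (eqVneq i j) ki => [<-|_]; lia.
Qed.

Lemma dbarM p q : dbar (p * q) = dbar p * q + p * dbar q.
Proof.
suff dU k b :
    dbar (xmon k * xmon b) = dbar (xmon k) * xmon b + xmon k * dbar (xmon b).
  exact: (leibniz_ext xmonE (d := dbar) dU).
by rewrite xmonM !dbar_xmon dbar_monM.
Qed.

Lemma dbar_unique (d : {linear N -> N}) :
  (forall p q, d (p * q) = d p * q + p * d q) ->
  (forall i, d (xvar i) = if i.2 is n.+1 then xvar (i.1, n) else 0) ->
  d =1 dbar.
Proof.
move=> dM dx p; have d1 (e : N -> N) :
    (forall p q, e (p * q) = e p * q + p * e q) -> e 1 = 0.
  move=> /(_ 1 1); rewrite !mul1r mulr1 => /eqP.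
  by rewrite -subr_eq0 opprD addrA subrr sub0r oppr_eq0 => /eqP.
have dd1 : d 1 = dbar 1 := etrans (d1 d dM) (esym (d1 dbar dbarM)).
rewrite [p](basis_expand xmonE) !linear_sum; apply: eq_bigr => m _.
rewrite !linearZ /=; congr (_ *: _); rewrite /xmon.
elim/big_rec: _ => [|i q _ IHq]; first exact: dd1.
set t := _ ^+ _.
suff ddt : d t = dbar t.
  by apply: (etrans (dM t q)); rewrite ddt IHq; apply/esym/dbarM.
rewrite /t; elim: (m i) => [|n IHn]; first by rewrite expr0; exact: dd1.
rewrite exprS; set u := xvar i; set v := u ^+ n.
apply: (etrans (dM u v)); apply: (etrans _ (esym (dbarM u v))).
have du : d u = dbar u := etrans (dx i) (esym (dbar_xvar i)).
have dv : d v = dbar v := IHn.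
by clearbody u v; rewrite du dv.
Qed.

(* x^(b - l + lshift l), zero if the exponent has a negative component *)
Definition xlower b l : N :=
  if `[< lower_ge0 b (val l) >] then xmon (lower b (val l)) else 0.

Definition is_lowering_coef (C : multiindex A -> lowering A -> int) : Prop :=
  (forall b r, iter r dbar (xmon b) =
     \sum_(l \in [set l : lowering A | mdeg (val l) = r])
        (C b l)%:~R *: xlower b l)
  /\ (forall b l, ~ lower_ge0 b (val l) -> C b l = 0).

Lemma dbar_coef (p : N) m : (dbar p)@_m =
  \sum_(k <- msupp p) p@_k * \sum_(i <- finsupp k | (0 < i.2)%N)
    (k i)%:R * (mmul (ucm (i.1, i.2.-1)) (divcm k (ucm i)) == m)%:R.
Proof.
rewrite /dbar /lext raddf_sum; apply: eq_bigr => k _ /=; rewrite mcoeffZ.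
congr (_ * _); rewrite /dbar_mon raddf_sum; apply: eq_bigr => i _ /=.
by rewrite mcoeffZ xmon_coef.
Qed.

Lemma iter_dbar_int r b m :
  exists z : int, (iter r dbar (xmon b))@_m = z%:~R.
Proof.
pose isint (x : K) := exists z : int, x = z%:~R.
have int_sum (S : eqType) (s : seq S) (P : pred S) (f : S -> K) :
    (forall x, isint (f x)) -> isint (\sum_(x <- s | P x) f x).
  move=> fZ; apply: (big_ind isint) => [|x y [u ->] [v ->]|//].
    by exists 0.
  by exists (u + v); rewrite intrD.
have intM x y : isint x -> isint y -> isint (x * y).
  by move=> [u ->] [v ->]; exists (u * v); rewrite intrM.
have int_nat n : isint n%:R by exists n%:Z.
elim: r m => [|r IHr] m; first by rewrite /= xmon_coef; exact: int_nat.
rewrite iterS dbar_coef; apply/int_sum => k; apply/intM; first exact: IHr.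
by apply/int_sum => i; apply/intM; exact: int_nat.
Qed.

Lemma iter_dbar_supp r b m : (iter r dbar (xmon b))@_m != 0 ->
  exists l : lowering A,
    [/\ mdeg (val l) = r, lower_ge0 b (val l) & m = lower b (val l)].
Proof.
elim: r m => [|r IHr] m.
  rewrite /= xmon_coef; case: (eqVneq b m) => [<- _|_]; last by rewrite mulr0n eqxx.
  have l0 : is_lowering (mone : multiindex A).
    by apply/forallP => a; rewrite cm1.
  exists (Sub mone l0); rewrite SubK mdeg1; split=> // [i|].
    by rewrite /lowerz lshiftE !cm1; lia.
  by apply/eqP/cmP => i; rewrite /lower divcmE cmM lshiftE !cm1; lia.
rewrite iterS dbar_coef => nz.
have [k nz1] : exists k, (iter r dbar (xmon b))@_k *
    (\sum_(i <- finsupp k | (0 < i.2)%N)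
    (k i)%:R * (mmul (ucm (i.1, i.2.-1)) (divcm k (ucm i)) == m)%:R) != 0.
  apply: contrapT => /forallNP H; case/negP: nz; apply/eqP/big1 => k _.
  by have /negP/negPn/eqP := H k.
have [pk sk] : (iter r dbar (xmon b))@_k != 0 /\
    (\sum_(i <- finsupp k | (0 < i.2)%N) (k i)%:R *
    (mmul (ucm (i.1, i.2.-1)) (divcm k (ucm i)) == m)%:R) != 0 :> K.
  by move: nz1; rewrite mulf_eq0 negb_or => /andP.
have [l [lr l_ge0 kE]] := IHr k pk.
have [i [i0 ki mE]] : exists i, [/\ (0 < i.2)%N, k i != 0%N &
    mmul (ucm (i.1, i.2.-1)) (divcm k (ucm i)) = m].
  apply: contrapT => /forallNP H; case/negP: sk; apply/eqP/big1 => i i0.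
  case: (_ =P m) => mE; last by rewrite mulr0.
  have [->|ki] := eqVneq (k i) 0%N; first by rewrite mul0r.
  by case: (H i).
have l1 : is_lowering (mmul (val l) (ucm i)).
  apply/forallP => a; rewrite cmM lowering0 cmU.
  by have /negPf-> : i != (a, 0%N) by apply: contraTneq i0 => ->.
have l1E j : lowerz b (mmul (val l) (ucm i)) j =
    (k j)%:Z - (i == j)%:Z + ((i.1, i.2.-1) == j)%:Z.
  rewrite kE lowerE // /lowerz !lshiftE !cmM !cmU.
  have -> : (i == (j.1, j.2.+1)) = ((i.1, i.2.-1) == j).
    by move: i0; clear; case: i j => a [|n] [a' n'].
  by rewrite !PoszD; ring.
have l1_ge0 : lower_ge0 b (mmul (val l) (ucm i)).
  move=> j; rewrite l1E; case: (eqVneq i j) => [<-|_]; last by lia.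
  by move: ki; rewrite -lt0n => ki; lia.
exists (Sub _ l1); rewrite SubK mdegM mdegU addn1 lr; split=> //.
rewrite -mE; apply/eqP/cmP => j; apply: (can_inj absz_nat).
rewrite (lowerE j l1_ge0) l1E cmM divcmE !cmU.
rewrite PoszD addrC; congr (_ + _); case: (eqVneq i j) => [<-|_] /=.
  by rewrite subzn // lt0n.
by rewrite subr0 subn0.
Qed.

Lemma fsum_lowerE (C : multiindex A -> lowering A -> int) b r m :
  (\sum_(l \in [set l : lowering A | mdeg (val l) = r])
     (C b l)%:~R *: xlower b l)@_m =
  \sum_(l <- fset_set [set l : lowering A | mdeg (val l) = r /\
                                            lower_ge0 b (val l)])
     (C b l)%:~R * (lower b (val l) == m)%:R.
Proof.
set D := (X in fset_set X); have fD : finite_set D := finite_lower b r.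
rewrite -(fsbig_widen D) => [|l []//|l [/= lr lD]]; last first.
  by rewrite /xlower asboolF ?scaler0 // => l_ge0; exact: lD.
rewrite fsbig_finite // raddf_sum big_seq [RHS]big_seq.
apply: eq_bigr => l; rewrite in_fset_set // inE => -[_ l_ge0] /=.
by rewrite mcoeffZ /xlower asboolT // xmon_coef.
Qed.

Lemma sum_lower1 (C : multiindex A -> lowering A -> int) b r l :
  mdeg (val l) = r -> lower_ge0 b (val l) ->
  \sum_(l' <- fset_set [set l : lowering A | mdeg (val l) = r /\
                                             lower_ge0 b (val l)])
     (C b l')%:~R * (lower b (val l') == lower b (val l))%:R
  = (C b l)%:~R :> K.
Proof.
set D := (X in fset_set X); have fD : finite_set D := finite_lower b r.
move=> lr l_ge0; rewrite (big_fsetD1 l) /=; last first.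
  by rewrite in_fset_set // inE.
rewrite eqxx mulr1 big_seq big1 ?addr0 // => l'.
rewrite in_fsetD1 in_fset_set // => /andP[ne_l /set_mem[_ l'_ge0]].
case: eqP => [/lower_inj|_]; last by rewrite mulr0.
by move=> /(_ l'_ge0 l_ge0) /eqP; rewrite (negPf ne_l).
Qed.

Lemma lowering_coef_exists : exists C, is_lowering_coef C.
Proof.
pose c b l : int :=
  projT1 (cid (iter_dbar_int (mdeg (val l)) b (lower b (val l)))).
have cE b l : (c b l)%:~R =
    (iter (mdeg (val l)) dbar (xmon b))@_(lower b (val l)) :> K.
  by rewrite /c; case: cid.
pose C b l : int := if `[< lower_ge0 b (val l) >] then c b l else 0.
exists C; split=> [b r|b l nge0]; last by rewrite /C asboolF.
apply/malgP => m; rewrite (fsum_lowerE C).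
have [[l [lr l_ge0 ->]]|noL] := pselect (exists l,
    [/\ mdeg (val l) = r, lower_ge0 b (val l) & m = lower b (val l)]).
  by rewrite (sum_lower1 C) // /C asboolT // cE lr.
have /eqP -> : (iter r dbar (xmon b))@_m == 0.
  by apply/negPn/negP => /iter_dbar_supp.
rewrite big_seq big1 // => l; rewrite in_fset_set; last exact: finite_lower.
move=> /set_mem[lr l_ge0]; case: eqP => [lE|_]; last by rewrite mulr0.
by case: noL; exists l.
Qed.

Lemma lowering_coef_unique C C' : [pchar K] =i pred0 ->
  is_lowering_coef C -> is_lowering_coef C' -> C = C'.
Proof.
move=> charK [CE C0] [C'E C'0]; apply/funext => b; apply/funext => l.
have [l_ge0|nge0] := pselect (lower_ge0 b (val l)); last first.
  by rewrite C0 // C'0.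
pose m := lower b (val l); pose r := mdeg (val l).
have e1 := congr1 (mcoeff m) (etrans (esym (CE b r)) (C'E b r)).
have e2 := etrans (esym (fsum_lowerE C b r m)) e1.
have e3 := etrans e2 (fsum_lowerE C' b r m).
have e4 := etrans (esym (sum_lower1 C erefl l_ge0)) e3.
have /eqP := etrans e4 (sum_lower1 C' erefl l_ge0).
rewrite -subr_eq0 -intrB => e.
apply/eqP; rewrite -subr_eq0; move: e; case: (_ - _) => n.
  by rewrite -pmulrn (proj1 (pcharf0P K) charK).
by rewrite NegzE mulrNz oppr_eq0 -pmulrn (proj1 (pcharf0P K) charK).
Qed.

(* the integers C_{b, l} *)
Definition lowering_coef : multiindex A -> lowering A -> int :=
  projT1 (cid lowering_coef_exists).

Lemma lowering_coefP : is_lowering_coef lowering_coef.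
Proof. exact: projT2. Qed.

(* the integers D_{b, l} *)
Definition lowering_dcoef b l : int :=
  if `[< lower_ge0 b (val l) >]
  then lowering_coef b l * (mfact (lower b (val l)))%:Z else 0.

Definition Vpred : {pred N} := fun p => all (fun k => wt k == -1) (msupp p).

Lemma Vpred_closed : submod_closed Vpred.
Proof.
split=> [|c p q /allP pV /allP qV]; first by rewrite /in_mem /= /Vpred msupp0.
apply/allP => k /(fsubsetP (msuppD_le _ _)); rewrite in_fsetU.
by case/orP=> [/(fsubsetP (msuppZ_le _ _))|]; [exact: pV|exact: qV].
Qed.
HB.instance Definition _ := GRing.isSubmodClosed.Build K N Vpred Vpred_closed.

Record Vspan : predArgType := VSpan { Vval :> N; _ : Vval \in Vpred }.
HB.instance Definition _ := [isSub for Vval].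
HB.instance Definition _ := [Choice of Vspan by <:].
HB.instance Definition _ := [SubChoice_isSubLmodule of Vspan by <:].

Lemma xmon_Vpred k : wt k = -1 -> xmon k \in Vpred.
Proof.
move=> wk; apply/allP => b; rewrite -mcoeff_neq0 xmon_coef.
by case: (k =P b) => [<- _|_]; [apply/eqP|rewrite mulr0n eqxx].
Qed.

Definition Vmon k (wk : wt k = -1) : Vspan := VSpan (xmon_Vpred wk).

(* the scalar k! / (sigma(x^{k^1} (.) ... (.) x^{k^r}) b!) for p = (F, b) *)
Definition LOT_coef k (p : multiset A * multiindex A) : K :=
  (mfact k)%:R / (symfactor p.1 * mfact p.2)%:R.

Definition DeltaLOT_mon k : {malg K[(multiset A * multiindex A)%type]} :=
  \sum_(r \in [set: nat]) \sum_(p \in decomp k r)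
     LOT_coef k p *: tens (odot p.1) (iter r dbar (xmon p.2)).

Definition DeltaLOT (v : Vspan) : {malg K[(multiset A * multiindex A)%type]} :=
  lext DeltaLOT_mon (Vval v).

Lemma DeltaLOT_linear : linear DeltaLOT.
Proof. by move=> c v w; rewrite /DeltaLOT linearP. Qed.

HB.instance Definition _ := GRing.isLinear.Build K Vspan
  {malg K[(multiset A * multiindex A)%type]} *:%R DeltaLOT DeltaLOT_linear.

Lemma DeltaLOT_Vmon k (wk : wt k = -1) : DeltaLOT (Vmon wk) = DeltaLOT_mon k.
Proof. by rewrite /DeltaLOT /Vmon /= xmonE lextU scale1r. Qed.

End Algebra.

(* Main.v *)
Require Import Defs.
From HB Require Import structures.
From mathcomp Require Import all_boot all_order all_algebra finmap.
From mathcomp Require Import monalg.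
From mathcomp Require Import boolp classical_sets functions cardinality fsbigop.

Set Implicit Arguments.
Unset Strict Implicit.
Unset Printing Implicit Defensive.

Import Order.TTheory GRing.Theory Num.Theory.

Local Open Scope classical_set_scope.
Local Open Scope ring_scope.

(** Both formulas follow from the definition of the coproduct term by term: for fixed [r] and
    decomposition [(F, b)], expand [iter r dbar] of [xmon K b] by the defining property of the
    coefficients C, and move the sum through the tensor product, which is linear in its right factor
    ([tens_iter_dbar]). Only the finitely many [l] with b - l + lshift l nonnegative contribute.
    Summing over these or over all |l| = r gives the same value ([fsum_lower_widen]), whence the
    first formula; on these, D divided by the factorial is C ([lowering_dcoef_div]), whence the
    second. *)

HB.instance Definition _ (M M' : choiceType) (K : fieldType) (p : {malg K[M]}) :=
  GRing.isLinear.Build K {malg K[M']} {malg K[(M * M')%type]} *:%R (tens p)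
    (@tens_linearr M M' K p).

Section LowerSums.
Variables (A : finType) (K : fieldType).
Implicit Types (b : multiindex A).

(** Finiteness of [D] turns both sides into ordinary finite sums, to which additivity of [tens p]
    applies. *)
Lemma tens_fsumr (M M' I : choiceType) (p : {malg K[M]}) (D : set I)
    (f : I -> {malg K[M']}) : finite_set D ->
  tens p (\sum_(i \in D) f i) = \sum_(i \in D) tens p (f i).
Proof. by move=> fD; rewrite !fsbig_finite // raddf_sum. Qed.

Lemma xlower_ge0 b (l : lowering A) : lower_ge0 b (val l) ->
  xlower K b l = xmon K (lower b (val l)).
Proof. by move=> l_ge0; rewrite /xlower asboolT. Qed.

Lemma xlower_eq0 b (l : lowering A) : ~ lower_ge0 b (val l) ->
  xlower K b l = 0.
Proof. by move=> nge0; rewrite /xlower asboolF. Qed.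

(** The added terms vanish, since [xlower] is 0 when a component is negative. The map [g] lets the
    lemma serve both before tensoring ([id]) and after ([tens p]). *)
Lemma fsum_lower_widen b r (U : lmodType K) (c : lowering A -> K)
    (g : {malg K[multiindex A]} -> U) : g 0 = 0 ->
  \sum_(l \in [set l : lowering A | mdeg (val l) = r /\
                                    lower_ge0 b (val l)])
     c l *: g (xlower K b l) =
  \sum_(l \in [set l : lowering A | mdeg (val l) = r]) c l *: g (xlower K b l).
Proof.
move=> g0; apply: fsbig_widen => [l []//|l [/= lr nD]].
by rewrite xlower_eq0 ?g0 ?scaler0 // => l_ge0; exact: nD.
Qed.

Lemma tens_iter_dbar (M : choiceType) (p : {malg K[M]}) b r :
  tens p (iter r (@dbar A K) (xmon K b)) =
  \sum_(l \in [set l : lowering A | mdeg (val l) = r /\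
                                    lower_ge0 b (val l)])
    (lowering_coef K b l)%:~R *: tens p (xlower K b l).
Proof.
(* The set |l| = r is infinite; tens p only commutes with the sum once it is
   restricted to the finitely many l with b - l + lshift l >= 0. *)
rewrite (lowering_coefP A K).1 -(fsum_lower_widen _ _ _ (g := id)) //.
rewrite tens_fsumr; last exact: finite_lower.
by apply: eq_fsbigr => l _; rewrite linearZ.
Qed.

Lemma mfact_neq0 b : [pchar K] =i pred0 -> (mfact b)%:R != 0 :> K.
Proof.
move=> charK; rewrite ((pcharf0P K).1 charK) -lt0n.
by apply: prodn_gt0 => i; exact: fact_gt0.
Qed.

(** D is C times this factorial, which is invertible in characteristic zero. *)
Lemma lowering_dcoef_div b (l : lowering A) : [pchar K] =i pred0 ->
  lower_ge0 b (val l) ->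
  (lowering_dcoef K b l)%:~R / (mfact (lower b (val l)))%:R =
  (lowering_coef K b l)%:~R :> K.
Proof.
move=> charK l_ge0; rewrite /lowering_dcoef asboolT // intrM.
by rewrite -pmulrn mulfK // mfact_neq0.
Qed.

End LowerSums.

Theorem corollary5p6 (A : finType) (K : fieldType)
    (charK : [pchar K] =i pred0) (k : multiindex A) (wk : wt k = -1) :
  DeltaLOT (Vmon K wk) =
    \sum_(r \in [set: nat]) \sum_(p \in decomp k r) LOT_coef K k p *:
      \sum_(l \in [set l : lowering A | mdeg (val l) = r])
        (lowering_coef K p.2 l)%:~R *: tens (odot K p.1) (xlower K p.2 l)
  /\
  DeltaLOT (Vmon K wk) =
    \sum_(r \in [set: nat]) \sum_(p \in decomp k r) LOT_coef K k p *:
      \sum_(l \in [set l : lowering A | mdeg (val l) = r /\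
                                        lower_ge0 p.2 (val l)])
        ((lowering_dcoef K p.2 l)%:~R / (mfact (lower p.2 (val l)))%:R) *:
          tens (odot K p.1) (xmon K (lower p.2 (val l))).
Proof.
rewrite DeltaLOT_Vmon /DeltaLOT_mon; split; apply: eq_fsbigr => r _;
  apply: eq_fsbigr => -[F b] _; congr (_ *: _); rewrite tens_iter_dbar.
  (* First formula: widen from nonnegative exponents to all |l| = r, with [g] the tensor product by
     [odot K F]. *)
  by apply: fsum_lower_widen; exact: raddf0.
(* Second formula: both sums already range over the same restricted set, so they are compared
   termwise. *)
apply: eq_fsbigr => l /set_mem[_ l_ge0].
by rewrite (lowering_dcoef_div charK l_ge0) (xlower_ge0 K l_ge0).
Qed.
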